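(* Let $N$ be a positive integer and let $m_1,\dots,m_N>0$ be arbitrary masses. Then each central configuration in $\mathbb H^3$ (for the masses $m_1,\dots,m_N$) is equivalent to some central configuration lying on $\mathbb H^2_{xyw}$; that is, for every central configuration $\mathbf q=(\mathbf q_1,\dots,\mathbf q_N)\in(\mathbb H^3)^N\setminus\Delta$ there is an element $\chi$ of the group $SO(2)\times SO(1,1)$ such that $\chi\mathbf q=(\chi\mathbf q_1,\dots,\chi\mathbf q_N)$ is a central configuration with $\chi\mathbf q_i\in\mathbb H^2_{xyw}$ for all $i=1,\dots,N$.
   Context: Equip $\mathbb R^4$ with the Minkowski inner product $\mathbf q_1\cdot\mathbf q_2=x_1x_2+y_1y_2+z_1z_2-w_1w_2$ for $\mathbf q_i=(x_i,y_i,z_i,w_i)^T$. The unit hyperbolic sphere is $\mathbb H^3=\{(x,y,z,w)^T\in\mathbb R^4 : x^2+y^2+z^2-w^2=-1,\ w>0\}$, with the Riemannian metric induced by this inner product. Define $\mathbb H^2_{xyw}=\{(x,y,z,w)^T\in\mathbb H^3 : z=0\}$. A configuration of $N$ point masses $m_1,\dots,m_N>0$ is $\mathbf q=(\mathbf q_1,\dots,\mathbf q_N)\in(\mathbb H^3)^N$. The singularity set is $\Delta=\bigcup_{1\le i<j\le N}\{\mathbf q\in(\mathbb H^3)^N : \mathbf q_i\cdot\mathbf q_j=\pm1\}$. The geodesic distance is $d_{ij}=\operatorname{arccosh}(-\mathbf q_i\cdot\mathbf q_j)$. The force function on $(\mathbb H^3)^N\setminus\Delta$ is $U(\mathbf q)=\sum_{1\le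 i<j\le N}m_im_j\coth d_{ij}$, and $I(\mathbf q)=\sum_{i=1}^N m_i(x_i^2+y_i^2)$. Let $\nabla_{\mathbf q_i}$ denote the Riemannian gradient on $\mathbb H^3$ with respect to the $i$-th point $\mathbf q_i$ (the other points fixed). Explicitly, $$\nabla_{\mathbf q_i}U=\sum_{j\ne i}\frac{m_im_j[\mathbf q_j-\cosh d_{ij}\,\mathbf q_i]}{\sinh^3 d_{ij}},\qquad \nabla_{\mathbf q_i}I=2m_i\big(x_i(w_i^2-z_i^2),\,y_i(w_i^2-z_i^2),\,z_i(x_i^2+y_i^2),\,w_i(x_i^2+y_i^2)\big)^T.$$ A configuration $\mathbf q\in(\mathbb H^3)^N\setminus\Delta$ is a central configuration if there is a constant $\lambda\in\mathbb R$ such that $\nabla_{\mathbf q_i}U(\mathbf q)=\lambda\nabla_{\mathbf q_i}I(\mathbf q)$ for all $i=1,\dots,N$. The group $SO(2)\times SO(1,1)$ acts on $\mathbb H^3$ (and diagonally on $(\mathbb H^3)^N$): $SO(2)$ acts by rotations on the coordinates $(x,y)$, and $SO(1,1)$ acts on the coordinates $(z,w)$ by the hyperbolic rotations $\begin{bmatrix}\cosh s&\sinh s\\ \sinh s&\cosh s\end{bmatrix}$, $s\in\mathbb R$. Two central configurations are equivalent if one is transformed to the other by an element of this group. *)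

(* Defs.v *)
From HB Require Import structures.
From mathcomp Require Import all_boot all_order all_algebra.
From mathcomp Require Import all_classical all_reals all_analysis.
Set Implicit Arguments.
Unset Strict Implicit.
Unset Printing Implicit Defensive.
Import Order.TTheory GRing.Theory Num.Theory.
Import numFieldNormedType.Exports.
Local Open Scope classical_set_scope.
Local Open Scope ring_scope.

Section Hyperbolic.
Context {R : realType}.

Definition cosh (s : R) : R := (expR s + expR (- s)) / 2.
Definition sinh (s : R) : R := (expR s - expR (- s)) / 2.
Definition coth (s : R) : R := cosh s / sinh s.

(* Inverse of [cosh] on [0, +oo[; only meaningful for 1 <= c. *)
Definition arccosh (c : R) : R := ln (c + Num.sqrt (c ^+ 2 - 1)).

End Hyperbolic.

Section Minkowski.
Context {R : realType}.
Implicit Types u v p : 'cV[R]_4.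

Definition xc v : R := v (@Ordinal 4 0 isT) ord0.
Definition yc v : R := v (@Ordinal 4 1 isT) ord0.
Definition zc v : R := v (@Ordinal 4 2 isT) ord0.
Definition wc v : R := v (@Ordinal 4 3 isT) ord0.

Definition mink u v : R :=
  xc u * xc v + yc u * yc v + zc u * zc v - wc u * wc v.

Definition H3 : set 'cV[R]_4 := [set v | mink v v = -1 /\ 0 < wc v].

Definition H2xyw : set 'cV[R]_4 := [set v | H3 v /\ zc v = 0].

(* The tangent space of H3 at p is {v | mink v p = 0}, and the metric on it is
   the restriction of [mink].  So the gradient at p of a function F on H3 is the
   tangent vector g with dF_p(u) = mink g u for all tangent u; dF_p(u) is
   computed along curves in H3 with velocity u at p. *)
Definition is_riemannian_gradient (F : 'cV[R]_4 -> R) (p g : 'cV[R]_4) : Prop :=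
  mink g p = 0 /\
  forall (gamma : R -> 'cV[R]_4) (u : 'cV[R]_4),
    (forall t, H3 (gamma t)) -> gamma 0 = p -> is_derive (0 : R) 1 gamma u ->
    is_derive (0 : R) 1 (F \o gamma) (mink g u).

End Minkowski.

Section Configurations.
Context {R : realType} {N : nat}.
Implicit Types (m : 'I_N -> R) (q : 'I_N -> 'cV[R]_4).

Definition H3conf : set ('I_N -> 'cV[R]_4) := [set q | forall i, H3 (q i)].

Definition singular : set ('I_N -> 'cV[R]_4) :=
  [set q | H3conf q /\ exists i j : 'I_N,
    (i < j)%N /\ (mink (q i) (q j) = 1 \/ mink (q i) (q j) = -1)].

Definition geodist q (i j : 'I_N) : R := arccosh (- mink (q i) (q j)).

Definition force_function m q : R :=
  \sum_(i < N) \sum_(j < N | (i < j)%N) m i * m j * coth (geodist q i j).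

Definition moment m q : R :=
  \sum_(i < N) m i * (xc (q i) ^+ 2 + yc (q i) ^+ 2).

Definition set_point q (i : 'I_N) (p : 'cV[R]_4) : 'I_N -> 'cV[R]_4 :=
  fun j => if j == i then p else q j.

Definition is_partial_gradient (F : ('I_N -> 'cV[R]_4) -> R) q (i : 'I_N)
    (g : 'cV[R]_4) : Prop :=
  is_riemannian_gradient (fun p => F (set_point q i p)) (q i) g.

Definition central_configuration m q : Prop :=
  (H3conf `\` singular) q /\
  exists lambda : R, forall i : 'I_N, exists gU gI : 'cV[R]_4,
    [/\ is_partial_gradient (force_function m) q i gU,
        is_partial_gradient (moment m) q i gI
      & gU = lambda *: gI].

End Configurations.

Section Group.
Context {R : realType}.

Definition SO2 : set 'M[R]_2 := [set A | A^T *m A = 1%:M /\ \det A = 1].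

Definition hyperbolic_rotation (s : R) : 'M[R]_2 :=
  \matrix_(i, j) if i == j then cosh s else sinh s.

(* The hyperbolic rotations form the identity component of the full special
   pseudo-orthogonal group, i.e. the part that preserves w > 0. *)
Definition SO11 : set 'M[R]_2 := range hyperbolic_rotation.

Definition SO2xSO11 : set 'M[R]_(2 + 2) :=
  [set chi | exists A B, [/\ SO2 A, SO11 B & chi = block_mx A 0 0 B]].

Definition act {N : nat} (chi : 'M[R]_(2 + 2)) (q : 'I_N -> 'cV[R]_4) :
    'I_N -> 'cV[R]_4 :=
  fun i => (chi : 'M[R]_4) *m q i.

End Group.

(* Main.v *)
Require Import Defs.
From mathcomp Require Import all_boot all_order all_algebra.
From mathcomp Require Import all_classical all_reals all_analysis.
From mathcomp Require Import ring lra.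
Import Order.TTheory GRing.Theory Num.Theory.
Import numFieldNormedType.Exports.
Local Open Scope classical_set_scope.
Local Open Scope ring_scope.

(* Boosts in the (z, w)-plane preserve the moment, so in a central configuration
   the force on each point has no component along its boost direction. For the
   point q_i this component is a sum over j of positive multiples of
   w_i z_j - z_i w_j, which has the sign of z_j / w_j - z_i / w_i. If z_i / w_i is
   minimal, all terms are nonnegative, hence zero, so all points share the same
   ratio z / w. The boost taking q_i to the plane z = 0 then does so for every
   point, and boosts are isometries preserving the force function and the moment,
   so they carry central configurations to central configurations. *)

(** * Hyperbolic functions and their derivatives *)

Lemma cosh_sqrB_sinh_sqr (R : realType) (s : R) : cosh s ^+ 2 - sinh s ^+ 2 = 1.
Proof.
suff -> : cosh s ^+ 2 - sinh s ^+ 2 = expR s * expR (- s) by rewrite expRxMexpNx_1.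
by rewrite /cosh /sinh; field.
Qed.

Lemma cosh0 (R : realType) : cosh (0 : R) = 1.
Proof. by rewrite /cosh oppr0 expR0; field. Qed.

Lemma sinh0 (R : realType) : sinh (0 : R) = 0.
Proof. by rewrite /sinh oppr0 subrr mul0r. Qed.

Lemma coshN (R : realType) (s : R) : cosh (- s) = cosh s.
Proof. by rewrite /cosh opprK addrC. Qed.

Lemma sinhN (R : realType) (s : R) : sinh (- s) = - sinh s.
Proof. by rewrite /sinh opprK -mulNr opprB. Qed.

Lemma is_derive_expRN (R : realType) (s : R) :
  is_derive s 1 (fun t : R => expR (- t)) (- expR (- s)).
Proof.
have h : is_derive s 1 (@expR R \o -%R) (expR (- s) * - 1) by exact: is_derive1_comp.
by apply: is_derive_eq h _; rewrite mulrN1.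
Qed.

Lemma is_derive_cosh (R : realType) (s : R) : is_derive s 1 (@cosh R) (sinh s).
Proof.
have h := is_derive_expRN _ s.
have -> : @cosh R = 2^-1 \*: (@expR R + (fun t : R => expR (- t))).
  by apply/funext => t; rewrite /cosh mulrC.
by apply: is_derive_eq; rewrite /sinh mulrC.
Qed.

Lemma is_derive_sinh (R : realType) (s : R) : is_derive s 1 (@sinh R) (cosh s).
Proof.
have h := is_derive_expRN _ s.
have -> : @sinh R = 2^-1 \*: (@expR R - (fun t : R => expR (- t))).
  by apply/funext => t; rewrite /sinh mulrC.
by apply: is_derive_eq; rewrite /cosh mulrC opprK.
Qed.

(** With [r] the square root of [c ^+ 2 - 1], the product [(c + r) * (c - r)] is [1], so the
    exponentials of [arccosh c] and of its opposite are [c + r] and [c - r]. *)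
Lemma coth_arccosh (R : realType) (c : R) : 1 <= c ->
  coth (arccosh c) = c / Num.sqrt (c ^+ 2 - 1).
Proof.
move=> c1; have c2 : 0 <= c ^+ 2 - 1 by nra.
set r := Num.sqrt (c ^+ 2 - 1); have r0 : 0 <= r := sqrtr_ge0 _.
have r2 : r ^+ 2 = c ^+ 2 - 1 by rewrite sqr_sqrtr.
have cr0 : 0 < c + r by lra.
have e1 : expR (arccosh c) = c + r by rewrite lnK.
have e2 : expR (- arccosh c) = c - r.
  rewrite expRN e1; apply: (mulIf (lt0r_neq0 cr0)); rewrite mulVf ?lt0r_neq0//.
  by rewrite -subr_sqr r2 opprB addrC subrK.
by rewrite /coth /cosh /sinh e1 e2; congr (_ / _); field.
Qed.

Lemma is_derive_coth_arccosh (R : realType) (c : R) : 1 < c ->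
  is_derive c 1 (fun x : R => coth (arccosh x)) (- (Num.sqrt (c ^+ 2 - 1)) ^- 3).
Proof.
move=> c1; have c2 : 0 < c ^+ 2 - 1 by nra.
set g := fun x : R => x ^+ 2 - 1.
have dg : is_derive c 1 g (2 * c).
  by apply: is_derive_eq; rewrite subr0 -mulr2n mulr_natl scaler1.
have r0 : 0 < Num.sqrt (g c) by rewrite sqrtr_gt0.
have r2 : Num.sqrt (g c) ^+ 2 = c ^+ 2 - 1 by rewrite sqr_sqrtr// ltW.
have dr : is_derive c 1 (fun x => Num.sqrt (g x)) ((2 * Num.sqrt (g c))^-1 * (2 * c)).
  exact: (@is_derive1_comp _ Num.sqrt g _ _ _ (is_derive1_sqrt c2)).
have dV := @is_deriveV _ (fun x => Num.sqrt (g x)) _ _ _ (lt0r_neq0 r0) dr.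
(* The closed form is available for [1 <= x], which holds on a neighbourhood of [c] because [1 < c]
   is strict. *)
apply: (@near_eq_is_derive _ _ _ (id * (fun x : R => (Num.sqrt (g x))^-1))).
  by near=> x; rewrite coth_arccosh//; near: x; exact: lt_le_nbhsr.
apply: is_derive_eq; rewrite -/(g c).
set r := Num.sqrt (g c) in r0 r2 *.
rewrite /GRing.scale /=.
(* The numerator [1] is written as [c ^+ 2 - r ^+ 2] to match the quotient rule. *)
have -> : r ^- 3 = (c ^+ 2 - r ^+ 2) / r ^+ 3.
  by rewrite r2 opprB addrC subrK mul1r.
by field; rewrite lt0r_neq0.
Unshelve. all: by end_near. Qed.

(** * Entrywise differentiation of matrix-valued maps *)

Lemma is_derive_mxP (R : realType) m n (M : R -> 'M[R]_(m, n)) (t v : R) dM :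
  is_derive t v M dM <-> forall i j, is_derive t v (fun x => M x i j) (dM i j).
Proof.
split=> [[dM1 <-] i j|h].
  split; first by have /derivable_mxP := dM1.
  by rewrite derive_mx // mxE.
have d : derivable M t v by apply/derivable_mxP => i j; have [] := h i j.
split=> //; rewrite derive_mx //; apply/matrixP => i j; rewrite mxE.
by have [] := h i j.
Qed.

Lemma is_derive_mulmx (R : realType) m n p (A : 'M[R]_(m, n)) (M : R -> 'M[R]_(n, p))
    (t v : R) dM :
  is_derive t v M dM -> is_derive t v (fun x => A *m M x) (A *m dM).
Proof.
move=> /is_derive_mxP h; apply/is_derive_mxP => i j; rewrite mxE.
under eq_fun do rewrite mxE.
rewrite (_ : (fun _ => _) = \sum_k A i k \*: (fun x => M x k j)); last first.
  by apply/funext => x; rewrite fct_sumE.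
exact: is_derive_sum.
Qed.

(** * Boosts as isometries of the hyperbolic space *)

Definition boost {R : realType} (s : R) : 'M[R]_(2 + 2) :=
  block_mx 1%:M 0 0 (hyperbolic_rotation s).

Lemma boost0 (R : realType) : boost (0 : R) = 1%:M.
Proof.
rewrite /boost scalar_mx_block; congr block_mx.
by apply/matrixP => i j; rewrite !mxE cosh0 sinh0; case: eqP.
Qed.

Lemma boost_SO2xSO11 (R : realType) (s : R) : SO2xSO11 (boost s).
Proof.
exists 1%:M, (hyperbolic_rotation s); split=> //; last by exists s.
by rewrite /SO2/= trmx1 mulmx1 det1.
Qed.

Lemma boost_mulE (R : realType) (s : R) (v : 'cV[R]_(2 + 2)) :
  boost s *m v = col_mx (usubmx v) (hyperbolic_rotation s *m dsubmx v).
Proof.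
by rewrite -[in LHS](vsubmxK v) mul_block_col mul1mx !mul0mx addr0 add0r.
Qed.

(** Bridges the literal indices used by [xc], [yc], [zc], [wc] and the shifted indices of block
    matrices. *)
Lemma ord4E : ((@Ordinal 4 0 isT = lshift 2 (ord0 : 'I_2)) *
  (@Ordinal 4 1 isT = lshift 2 (ord_max : 'I_2)) *
  (@Ordinal 4 2 isT = rshift 2 (ord0 : 'I_2)) *
  (@Ordinal 4 3 isT = rshift 2 (ord_max : 'I_2)))%type.
Proof. by split; [split; [split|]|]; apply: val_inj. Qed.

Lemma boost_coords (R : realType) (s : R) (v : 'cV[R]_4) :
  let p := (boost s : 'M[R]_4) *m v in
  [/\ xc p = xc v, yc p = yc v,
      zc p = cosh s * zc v + sinh s * wc v
    & wc p = sinh s * zc v + cosh s * wc v].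
Proof.
have h := boost_mulE R s v.
rewrite /xc /yc /zc /wc /= h !ord4E; split.
- by rewrite (@col_mxEu _ 2 2) mxE.
- by rewrite (@col_mxEu _ 2 2) mxE.
- rewrite (@col_mxEd _ 2 2) !mxE !big_ord_recl big_ord0 !mxE addr0 /=.
  by rewrite (_ : lift ord0 ord0 = ord_max) //; apply: val_inj.
- rewrite (@col_mxEd _ 2 2) !mxE !big_ord_recl big_ord0 !mxE addr0 /=.
  by rewrite (_ : lift ord0 ord0 = ord_max) //; apply: val_inj.
Qed.

Lemma minkC (R : realType) (u v : 'cV[R]_4) : mink u v = mink v u.
Proof. by rewrite /mink; ring. Qed.

Lemma mink_boost (R : realType) (s : R) (u v : 'cV[R]_4) :
  mink ((boost s : 'M[R]_4) *m u) ((boost s : 'M[R]_4) *m v) = mink u v.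
Proof.
have [xu yu zu wu] := boost_coords R s u.
have [xv yv zv wv] := boost_coords R s v.
have c2 : cosh s ^+ 2 = 1 + sinh s ^+ 2.
  by rewrite -(cosh_sqrB_sinh_sqr R s) subrK.
by rewrite /mink xu yu zu wu xv yv zv wv; ring: c2.
Qed.

Lemma boostNK (R : realType) (s : R) : boost (- s) *m boost s = 1%:M.
Proof.
rewrite /boost mulmx_block !mulmx0 !mul0mx mul1mx !addr0 add0r scalar_mx_block.
congr block_mx.
have h := cosh_sqrB_sinh_sqr R s.
apply/matrixP => -[[|[|//]] hi] [[|[|//]] hj];
  rewrite !mxE !big_ord_recl big_ord0 !mxE /= coshN sinhN.
all: by rewrite -?h; ring.
Qed.

Lemma boostK (R : realType) (s : R) p (v : 'M[R]_(4, p)) :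
  (boost (- s) : 'M[R]_4) *m ((boost s : 'M[R]_4) *m v) = v.
Proof. by rewrite mulmxA boostNK mul1mx. Qed.

Lemma boostVK (R : realType) (s : R) p (v : 'M[R]_(4, p)) :
  (boost s : 'M[R]_4) *m ((boost (- s) : 'M[R]_4) *m v) = v.
Proof. by rewrite -{1}(opprK s) boostK. Qed.

(** On [H3], [w^2 - z^2 = 1 + x^2 + y^2] is positive; together with [w > 0] this gives [|z| < w]. *)
Lemma H3_zw_gt0 (R : realType) (v : 'cV[R]_4) : H3 v ->
  0 < wc v + zc v /\ 0 < wc v - zc v.
Proof.
rewrite /H3 /mink /= => -[h w0].
have h2 : zc v ^+ 2 < wc v ^+ 2.
  have := sqr_ge0 (xc v); have := sqr_ge0 (yc v); nra.
by split; nra.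
Qed.

Lemma H3_boost (R : realType) (s : R) (v : 'cV[R]_4) :
  H3 v -> H3 ((boost s : 'M[R]_4) *m v).
Proof.
move=> hv; have [a b] := H3_zw_gt0 R v hv; case: hv => h w0.
split; first by rewrite mink_boost.
have [_ _ _ ->] := boost_coords R s v.
have es := expR_gt0 s; have eNs := expR_gt0 (- s).
(* The new [w] equals [(e^s (w + z) + e^(-s) (w - z)) / 2], a sum of positive terms. *)
rewrite /cosh /sinh; nra.
Qed.

(* Lagrange's identity:
   [(1 + |a|^2) (1 + |b|^2) - (1 + a.b)^2 = |a - b|^2 + |a x b|^2]. *)
Lemma H3_mink_le (R : realType) (u v : 'cV[R]_4) : H3 u -> H3 v -> mink u v <= -1.
Proof.
rewrite /H3 /mink /= => -[hu wu] [hv wv].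
move: (xc u) (yc u) (zc u) (wc u) hu wu (xc v) (yc v) (zc v) (wc v) hv wv.
move=> x y z w h w0 x' y' z' w' h' w0'.
rewrite leNgt; apply/negP => hlt.
have p0 : 0 < w * w' by rewrite mulr_gt0.
have hs : (w * w') ^+ 2 < (1 + (x * x' + y * y' + z * z')) ^+ 2.
  by rewrite ltr_pXn2r ?nnegrE //; lra.
have e : (w * w') ^+ 2 = (1 + x ^+ 2 + y ^+ 2 + z ^+ 2) * (1 + x' ^+ 2 + y' ^+ 2 + z' ^+ 2).
  have -> : 1 + x ^+ 2 + y ^+ 2 + z ^+ 2 = w ^+ 2 by lra.
  have -> : 1 + x' ^+ 2 + y' ^+ 2 + z' ^+ 2 = w' ^+ 2 by lra.
  by rewrite exprMn.
have := sqr_ge0 (x - x'); have := sqr_ge0 (y - y'); have := sqr_ge0 (z - z').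
have := sqr_ge0 (x * y' - y * x'); have := sqr_ge0 (x * z' - z * x').
have := sqr_ge0 (y * z' - z * y').
nra.
Qed.

(** * Transport of gradients and central configurations by boosts *)

(** The inverse boost carries a test curve through the image of [p] back to one through [p]. Its
    velocity is carried back linearly, and [mink] is preserved. *)
Lemma riemannian_gradient_boost (R : realType) (F G : 'cV[R]_4 -> R) (s : R) p g :
  (forall x, G ((boost s : 'M[R]_4) *m x) = F x) ->
  is_riemannian_gradient F p g ->
  is_riemannian_gradient G ((boost s : 'M[R]_4) *m p) ((boost s : 'M[R]_4) *m g).
Proof.
move=> FG [gp dF]; split=> [|gamma u Hg g0 dg]; first by rewrite mink_boost.
have -> : G \o gamma = F \o (fun t => (boost (- s) : 'M[R]_4) *m gamma t).
  by apply/funext => t /=; rewrite -FG boostVK.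
rewrite -{1}(boostVK R s _ u) mink_boost; apply: dF.
- by move=> t; apply: H3_boost.
- by rewrite g0 boostK.
- exact: is_derive_mulmx.
Qed.

Lemma set_point_act (R : realType) N (A : 'M[R]_(2 + 2)) (q : 'I_N -> 'cV[R]_4) i p :
  set_point (act A q) i ((A : 'M[R]_4) *m p) = act A (set_point q i p).
Proof. by apply/funext => j; rewrite /set_point /act; case: ifP. Qed.

Lemma force_function_boost (R : realType) N (m : 'I_N -> R) (s : R) q :
  force_function m (act (boost s) q) = force_function m q.
Proof.
apply: eq_bigr => i _; apply: eq_bigr => j _.
by rewrite /geodist /act mink_boost.
Qed.

Lemma moment_boost (R : realType) N (m : 'I_N -> R) (s : R) q :
  moment m (act (boost s) q) = moment m q.
Proof.
by apply: eq_bigr => i _; rewrite /act; have [-> -> _ _] := boost_coords R s (q i).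
Qed.

Lemma central_configuration_boost (R : realType) N (m : 'I_N -> R) (s : R) q :
  central_configuration m q -> central_configuration m (act (boost s) q).
Proof.
move=> [[qH qD] [lambda grad]]; split.
  split=> [i|[_ [i [j]]]]; first exact/H3_boost/qH.
  by rewrite /act mink_boost => ij; apply: qD; split=> //; exists i, j.
exists lambda => i; have [gU [gI [dU dI gE]]] := grad i.
exists ((boost s : 'M[R]_4) *m gU), ((boost s : 'M[R]_4) *m gI).
split; last by rewrite gE scalemxAr.
- apply: (riemannian_gradient_boost _ _ _ _ _ _ _ dU) => x.
  by rewrite set_point_act force_function_boost.
- apply: (riemannian_gradient_boost _ _ _ _ _ _ _ dI) => x.
  by rewrite set_point_act moment_boost.
Qed.

(** * Derivative of the force function along a boost orbit *)

Lemma is_derive_psum (R : realType) n (P : pred 'I_n) (h : 'I_n -> R -> R)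
    (dh : 'I_n -> R) (x v : R) :
  (forall i, P i -> is_derive x v (h i) (dh i)) ->
  is_derive x v (fun t => \sum_(i < n | P i) h i t) (\sum_(i < n | P i) dh i).
Proof.
move=> H; rewrite [X in is_derive _ _ X _](_ : _ = \sum_(i < n | P i) h i).
  by elim/big_ind2 : _ => // [|] *; [exact: is_derive_cst|exact: is_deriveD].
by apply/funext => t; rewrite fct_sumE.
Qed.

(** Makes a boost orbit an admissible test curve for the gradients, with velocity left as an
    abstract derivative. *)
Lemma derivable_boost_mul (R : realType) (t : R) (v : 'cV[R]_4) :
  derivable (fun s => (boost s : 'M[R]_4) *m v) t 1.
Proof.
have dc := is_derive_cosh R t; have ds := is_derive_sinh R t.
apply/derivable_mxP => -[k hk] j; rewrite (ord1 j).
case: k hk => [|[|[|[|//]]]] hk; rewrite (bool_irrelevance hk isT).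
- rewrite (_ : (fun _ => _) = cst (xc v)); first exact: derivable_cst.
  by apply/funext => s; have [] := boost_coords R s v.
- rewrite (_ : (fun _ => _) = cst (yc v)); first exact: derivable_cst.
  by apply/funext => s; have [] := boost_coords R s v.
- rewrite (_ : (fun _ => _) = zc v \*: @cosh R + wc v \*: @sinh R).
    exact: ex_derive.
  apply/funext => s; have [_ _ + _] := boost_coords R s v; rewrite /zc => ->.
  by rewrite !fctE /GRing.scale /= mulrC [sinh s * _]mulrC.
- rewrite (_ : (fun _ => _) = zc v \*: @sinh R + wc v \*: @cosh R).
    exact: ex_derive.
  apply/funext => s; have [_ _ _] := boost_coords R s v; rewrite {1}/wc => ->.
  by rewrite !fctE /GRing.scale /= mulrC [cosh s * _]mulrC.
Qed.

Lemma is_derive_mink_boost (R : realType) (u v : 'cV[R]_4) :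
  is_derive (0 : R) 1 (fun s => - mink ((boost s : 'M[R]_4) *m u) v)
    (zc u * wc v - wc u * zc v).
Proof.
have dc := is_derive_cosh R 0; have ds := is_derive_sinh R 0.
pose K := - (xc u * xc v + yc u * yc v).
(* As a function of [s] the product is a constant plus a combination of [cosh] and [sinh]; at [0]
   only the [sinh] term contributes to the derivative. *)
rewrite [X in is_derive _ _ X _](_ : _ = cst K + ((wc u * wc v - zc u * zc v) \*: @cosh R
   + (zc u * wc v - wc u * zc v) \*: @sinh R)).
  apply: is_derive_eq; rewrite sinh0 cosh0 scaler0 !add0r.
  by rewrite /GRing.scale /= mulr1.
apply/funext => s; have [xu yu zu wu] := boost_coords R s u.
rewrite /mink xu yu zu wu /K !fctE -[X in _ = _ + X]/(_ * cosh s + _ * sinh s).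
ring.
Qed.

(* The [s]-derivative at [0] of [coth d(boost s u, v)]. *)
Definition pull {R : realType} (u v : 'cV[R]_4) : R :=
  Num.sqrt (mink u v ^+ 2 - 1) ^- 3 * (wc u * zc v - zc u * wc v).

Lemma is_derive_coth_boost (R : realType) (u v : 'cV[R]_4) :
  H3 u -> H3 v -> mink u v <> -1 ->
  is_derive (0 : R) 1
    (fun s => coth (arccosh (- mink ((boost s : 'M[R]_4) *m u) v))) (pull u v).
Proof.
move=> Hu Hv uv; have c1 : 1 < - mink u v.
  by rewrite ltrNr lt_neqAle H3_mink_le // andbT; apply/eqP.
have b0 : (boost 0 : 'M[R]_4) *m u = u by rewrite boost0 mul1mx.
have d := is_derive_mink_boost R u v.
have dc := is_derive_coth_arccosh R _ c1.
have := @is_derive1_comp _ (fun x => coth (arccosh x)) _ _ _ _ _ d.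
rewrite /= b0 => /(_ _ dc) h; apply: is_derive_eq h _.
by rewrite /pull sqrrN; ring.
Qed.

Lemma pull_ge0 (R : realType) (u v : 'cV[R]_4) : H3 u -> H3 v ->
  zc u / wc u <= zc v / wc v -> 0 <= pull u v.
Proof.
move=> [_ wu] [_ wv] h; rewrite mulr_ge0 ?invr_ge0 ?exprn_ge0 ?sqrtr_ge0 //.
by move: h; rewrite ler_pdivrMr // mulrAC ler_pdivlMr // subr_ge0 [wc u * _]mulrC.
Qed.

(** Distinctness of the points gives [mink u v < -1], so the square root is positive and the other
    factor must vanish. *)
Lemma pull_eq0 (R : realType) (u v : 'cV[R]_4) : H3 u -> H3 v ->
  mink u v <> -1 -> pull u v = 0 -> wc u * zc v = zc u * wc v.
Proof.
move=> Hu Hv uv /eqP; rewrite mulf_eq0 subr_eq0 => /orP[|/eqP //].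
rewrite invr_eq0 expf_eq0 /= gt_eqF // sqrtr_gt0.
have c1 : mink u v < -1 by rewrite lt_neqAle H3_mink_le // andbT; apply/eqP.
by nra.
Qed.

(** * Equality of the ratios [z / w] in a central configuration *)

Lemma central_configuration_collinear (R : realType) (N : nat) (m : 'I_N -> R)
    (q : 'I_N -> 'cV[R]_4) (i : 'I_N) :
  (forall j, 0 < m j) -> central_configuration m q ->
  (forall j, zc (q i) / wc (q i) <= zc (q j) / wc (q j)) ->
  forall j, wc (q i) * zc (q j) = zc (q i) * wc (q j).
Proof.
move=> m0 [[qH qD] [lambda grad]] imin.
(* [singular] lists pairs in increasing order; symmetry of [mink] covers the other order. *)
have nD a b : a != b -> mink (q a) (q b) <> -1.
  rewrite -val_eqE /= neq_ltn => /orP[ab|ba] e; apply: qD; split=> //.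
    by exists a, b; split=> //; right.
  by exists b, a; split=> //; right; rewrite minkC.
have b0 : (boost 0 : 'M[R]_4) *m q i = q i by rewrite boost0 mul1mx.
have [gU [gI [[_ dU] [_ dI] gE]]] := grad i.
pose gamma (s : R) := (boost s : 'M[R]_4) *m q i.
have gH t : H3 (gamma t) by exact: H3_boost.
have dg : is_derive (0 : R) 1 gamma ('D_1 gamma 0).
  by split=> //; exact: derivable_boost_mul.
have {}dU := dU _ _ gH b0 dg.
have {}dI := dI _ _ gH b0 dg.
(* The moment is constant along the orbit, since boosts fix [x] and [y]. *)
have I0 : mink gI ('D_1 gamma 0) = 0.
  rewrite -(@derive_val _ _ _ _ _ _ _ dI).
  rewrite [X in 'D__ X _](_ : _ = cst (moment m q)) ?derive_cst //.
  apply/funext => s; apply: eq_bigr => j _; rewrite /set_point; case: eqP => // ->.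
  by have [-> -> _ _] := boost_coords R s (q i).
have U0 : mink gU ('D_1 gamma 0) = 0.
  have -> : mink gU ('D_1 gamma 0) = lambda * mink gI ('D_1 gamma 0).
    by rewrite gE /mink /xc /yc /zc /wc !mxE; ring.
  by rewrite I0 mulr0.
(* Derivative of the term of the pair [a < b] when only [q i] moves: the moving point may be either
   member, and pairs without it contribute [0]. *)
pose D a b := if a == i then pull (q i) (q b)
              else if b == i then pull (q i) (q a) else 0.
have dU' : is_derive (0 : R) 1
    ((fun p => force_function m (set_point q i p)) \o gamma)
    (\sum_(a < N) \sum_(b < N | (a < b)%N) m a * m b * D a b).
  apply: is_derive_psum => a _; apply: is_derive_psum => b ab.
  suff : is_derive (0 : R) 1
    (fun s => coth (geodist (set_point q i (gamma s)) a b)) (D a b).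
    by move=> h; exact: is_deriveZ.
  rewrite /geodist /set_point /D; have [ai|ai] := eqVneq a i.
    have bi : b != i by rewrite -ai -val_eqE /= gtn_eqF.
    rewrite (negbTE bi); apply: is_derive_coth_boost => //.
    by apply: nD; rewrite eq_sym.
  have [bi|bi] := eqVneq b i; last exact: is_derive_cst.
  under eq_fun do rewrite minkC.
  by apply: is_derive_coth_boost => //; apply: nD; rewrite eq_sym.
have D0 a b : 0 <= m a * m b * D a b.
  rewrite mulr_ge0 ?mulr_ge0 ?(ltW (m0 _)) // /D.
  by case: ifP => _; [|case: ifP => // _]; exact: pull_ge0.
(* Both [dU] and [dU'] differentiate the same function at [0], so their values agree. *)
have S0 : \sum_(a < N) \sum_(b < N | (a < b)%N) m a * m b * D a b = 0.
  by rewrite -(@derive_val _ _ _ _ _ _ _ dU') (@derive_val _ _ _ _ _ _ _ dU).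
(* A vanishing sum of nonnegative terms has only zero terms; this is applied to the outer sum, then
   to the inner one. *)
have Dab0 (a b : 'I_N) : (a < b)%N -> D a b = 0.
  have Sa : \sum_(c < N | (a < c)%N) m a * m c * D a c = 0.
    by apply: psumr_eq0P S0 _ _ => // c _; exact: sumr_ge0.
  move=> ab; have /eqP : m a * m b * D a b = 0 by apply: psumr_eq0P Sa _ _.
  by rewrite !mulf_eq0 !(gt_eqF (m0 _)) /= => /eqP.
move=> j; have [->|ji] := eqVneq j i; first by rewrite mulrC.
apply: pull_eq0 => //; first by apply: nD; rewrite eq_sym.
move: (ji); rewrite -val_eqE /= neq_ltn => /orP[h|h]; have := Dab0 _ _ h.
  by rewrite /D (negbTE ji) eqxx.
by rewrite /D eqxx.
Qed.

(** * Choice of the boost and conclusion *)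

(** With [x = e^s] the equation reads [x^2 (w + z) = w - z], and both [w + z] and [w - z] are
    positive on [H3]. *)
Lemma boost_to_zc0 (R : realType) (v : 'cV[R]_4) : H3 v ->
  exists s : R, cosh s * zc v + sinh s * wc v = 0.
Proof.
move=> /H3_zw_gt0 [wp wm].
set r := (wc v - zc v) / (wc v + zc v).
have r0 : 0 < r by rewrite divr_gt0.
have x0 : 0 < Num.sqrt r by rewrite sqrtr_gt0.
have x2 : Num.sqrt r ^+ 2 * (wc v + zc v) = wc v - zc v.
  by rewrite sqr_sqrtr ?ltW // divfK // lt0r_neq0.
exists (ln (Num.sqrt r)); rewrite /cosh /sinh expRN lnK //.
set x := Num.sqrt r in x0 x2 *.
have -> : (x + x^-1) / 2 * zc v + (x - x^-1) / 2 * wc v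
   = (x ^+ 2 * (wc v + zc v) - (wc v - zc v)) / (2 * x) by field; rewrite lt0r_neq0.
by rewrite x2 subrr mul0r.
Qed.

Theorem theorem1 (R : realType) (N : nat) (hN : (0 < N)%N) (m : 'I_N -> R)
    (hm : forall i : 'I_N, 0 < m i) (q : 'I_N -> 'cV[R]_4)
    (hq : central_configuration m q) :
  exists chi : 'M[R]_(2 + 2),
    [/\ SO2xSO11 chi,
        central_configuration m (act chi q)
      & forall i : 'I_N, H2xyw (act chi q i)].
Proof.
(* [Ordinal hN] is the index [0], supplied as the default element that [arg min] requires. *)
pose i := [arg min_(i < Ordinal hN) (zc (q i) / wc (q i))]%O.
have imin j : zc (q i) / wc (q i) <= zc (q j) / wc (q j).
  by rewrite /i; case: Order.TotalTheory.arg_minP => // k _; exact.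
have col := central_configuration_collinear _ _ _ _ _ hm hq imin.
have qH : H3conf q by case: hq => -[].
have [s s0] := boost_to_zc0 _ _ (qH i).
exists (boost s); split; [exact: boost_SO2xSO11|exact: central_configuration_boost|].
move=> j; split; first exact: H3_boost.
have [_ _ -> _] := boost_coords R s (q j).
have wi : wc (q i) != 0 by rewrite lt0r_neq0 //; case: (qH i).
(* After multiplication by [wc (q i)], the relation [col] turns the new [z] of [q j] into [wc (q j)]
   times the new [z] of [q i], which is [0] by the choice of [s]. *)
apply: (mulfI wi); rewrite mulr0 mulrDr mulrCA col.
by transitivity (wc (q j) * (cosh s * zc (q i) + sinh s * wc (q i)));
  [ring|rewrite s0 mulr0].
Qed.
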